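(* Let $A,E\in\mathbb{R}^{m\times n}$ and $1\le k\le\operatorname{rank}(A)$. Let $U_k\in\mathbb{R}^{m\times k}$ consist of $k$ dominant left singular vectors of $A$, and let $\hat U_k\in\mathbb{R}^{m\times k}$ consist of $k$ dominant left singular vectors of $A+E$. Then $$\|(I-U_kU_k^T)A\|_2\ \le\ \|(I-\hat U_k\hat U_k^T)A\|_2\ \le\ \|(I-U_kU_k^T)A\|_2+2\,\|E\|_2.$$
   Context: $\|\cdot\|_2$ is the matrix two-norm (largest singular value). ''$k$ dominant left singular vectors of $M$'' means the leading $k$ columns of $U$ in some full SVD $M=U\Sigma V^T$ ($U,V$ orthogonal, diagonal entries of $\Sigma$ being the singular values in non-increasing order); no singular value gap is assumed. *)

(* Defs.v *)
From mathcomp Require Import all_boot all_order all_algebra.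
From mathcomp Require Import classical_sets reals.
Set Implicit Arguments.
Unset Strict Implicit.
Unset Printing Implicit Defensive.
Import Order.TTheory GRing.Theory Num.Theory.
Local Open Scope ring_scope.
Local Open Scope classical_set_scope.

Definition orthogonal_mx (R : realType) (n : nat) (Q : 'M[R]_n) : Prop :=
  Q^T *m Q = 1%:M.

(* Full SVD: S is rectangular, so its diagonal entries are the S i j with
   i = j as natural numbers. *)
Definition is_svd (R : realType) (m n : nat) (A : 'M[R]_(m, n))
    (U : 'M[R]_m) (S : 'M[R]_(m, n)) (V : 'M[R]_n) : Prop :=
  [/\ orthogonal_mx U /\ orthogonal_mx V,
      is_diag_mx S,
      forall (i : 'I_m) (j : 'I_n), i = j :> nat -> 0 <= S i j,
      forall (i i' : 'I_m) (j j' : 'I_n), i = j :> nat -> i' = j' :> nat ->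
        (i <= i')%N -> S i' j' <= S i j
    & A = U *m S *m V^T].

Definition singular_values (R : realType) (m n : nat) (A : 'M[R]_(m, n)) :
    set R :=
  [set s | exists (U : 'M[R]_m) (S : 'M[R]_(m, n)) (V : 'M[R]_n)
             (i : 'I_m) (j : 'I_n),
     [/\ is_svd A U S V, i = j :> nat & s = S i j]].

(* Every matrix has a full SVD and its singular values are finitely many, so
   the supremum is the largest singular value; it is sup set0 = 0 for a matrix
   without rows or without columns. The library norm `|A| on matrices is the
   entrywise maximum and not this norm. *)
Definition two_norm (R : realType) (m n : nat) (A : 'M[R]_(m, n)) : R :=
  sup (singular_values A).

(* No gap is required, so U_k is in general not determined by M. *)
Definition dominant_left_singular_vectors (R : realType) (m n k : nat)
    (M : 'M[R]_(m, n)) (Uk : 'M[R]_(m, k)) : Prop :=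
  exists (U : 'M[R]_m) (S : 'M[R]_(m, n)) (V : 'M[R]_n) (le_km : (k <= m)%N),
    is_svd M U S V /\ Uk = colsub (widen_ord le_km) U.

(* Main.v *)
Require Import Defs.
From mathcomp Require Import all_boot all_order all_algebra.
From mathcomp Require Import boolp classical_sets reals.
From mathcomp Require Import topology normedtype derive.
From mathcomp Require Import ring lra.
Import Order.TTheory GRing.Theory Num.Theory.
Import numFieldNormedType.Exports.
Local Open Scope ring_scope.

(** The heart of the matter is the optimality half of the Eckart-Young theorem:
    projecting onto k dominant left singular vectors of M approximates M in the
    two-norm at least as well as any matrix B of rank at most k does
    ([dominant_projection_optimal]).  Given an SVD M = U S V^T, the residual of
    the projection is U T V^T, where T is S with its first k diagonal entries
    erased, so its norm is the largest surviving entry s_i with i >= k, indices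
    counting from 0 (or zero if none survives).  On the other hand B has rank
    at most i, so it kills a nonzero vector of the span of the first i + 1
    columns of V; on that span M stretches lengths by at least s_i, hence so
    does M - B somewhere ([svd_entry_le_dist]).

    Write P and Q for the projections onto the dominant vectors of A and of
    A + E.  The left inequality is optimality for A against the competitor Q A.
    For the right one, optimality for A + E against the competitor P A gives
      |(1 - Q) A| <= |(1 - Q)(A + E)| + |(1 - Q) E|
                  <= |A + E - P A| + |E| <= |(1 - P) A| + 2 |E|.

    The two-norm is defined as a supremum over all SVDs, so it is usable only
    once it is known to be the operator norm for the Euclidean length
    ([two_norm_le], [two_norm_bound]).  The second of these needs every matrix
    to have an SVD ([svd_exists]).  That is proved by deflation: a unit vector
    v maximising |A v| exists by compactness, it is an eigenvector of A^T A by
    the first-order condition, and Householder reflections moving the first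
    coordinate vectors to v and to A v / |A v| turn A into a block diagonal
    matrix with top entry |A v|, to which induction applies. *)

Set Implicit Arguments.
Unset Strict Implicit.
Unset Printing Implicit Defensive.

(** * Euclidean length of column vectors *)

Section Euclidean.
Variable R : realType.
Implicit Types m n p : nat.

Definition dot n (x y : 'cV[R]_n) : R := (x^T *m y) 0 0.

Definition enorm n (x : 'cV[R]_n) : R := Num.sqrt (dot x x).

Lemma dotE n (x y : 'cV[R]_n) : dot x y = \sum_i x i 0 * y i 0.
Proof. by rewrite /dot mxE; apply: eq_bigr => i _; rewrite mxE. Qed.

Lemma dotC n (x y : 'cV[R]_n) : dot x y = dot y x.
Proof. by rewrite !dotE; apply: eq_bigr => i _; rewrite mulrC. Qed.

Lemma dotDr n (x y z : 'cV[R]_n) : dot x (y + z) = dot x y + dot x z.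
Proof. by rewrite /dot mulmxDr mxE. Qed.

Lemma dotDl n (x y z : 'cV[R]_n) : dot (y + z) x = dot y x + dot z x.
Proof. by rewrite dotC dotDr !(dotC x). Qed.

Lemma dotZr n a (x y : 'cV[R]_n) : dot x (a *: y) = a * dot x y.
Proof. by rewrite /dot -scalemxAr mxE. Qed.

Lemma dotZl n a (x y : 'cV[R]_n) : dot (a *: x) y = a * dot x y.
Proof. by rewrite dotC dotZr dotC. Qed.

Lemma dot_mulmx m n (M : 'M[R]_(m, n)) x y : dot x (M *m y) = dot (M^T *m x) y.
Proof. by rewrite /dot trmx_mul trmxK mulmxA. Qed.

Lemma dot_ge0 n (x : 'cV[R]_n) : 0 <= dot x x.
Proof. by rewrite dotE sumr_ge0 // => i _; rewrite -expr2 sqr_ge0. Qed.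

Lemma dot_eq0 n (x : 'cV[R]_n) : (dot x x == 0) = (x == 0).
Proof.
apply/eqP/eqP => [|->]; last by rewrite /dot mulmx0 mxE.
rewrite dotE => /eqP; rewrite psumr_eq0 => [/allP x0|i _]; last first.
  by rewrite -expr2 sqr_ge0.
apply/colP => i; have := x0 i (mem_index_enum _).
by rewrite mulf_eq0 orbb mxE => /eqP.
Qed.

Lemma enorm_ge0 n (x : 'cV[R]_n) : 0 <= enorm x.
Proof. exact: sqrtr_ge0. Qed.

Lemma sqr_enorm n (x : 'cV[R]_n) : enorm x ^+ 2 = dot x x.
Proof. by rewrite sqr_sqrtr // dot_ge0. Qed.

Lemma enorm_eq0 n (x : 'cV[R]_n) : (enorm x == 0) = (x == 0).
Proof. by rewrite sqrtr_eq0 -dot_eq0 eq_le dot_ge0 andbT. Qed.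

Lemma enorm_le n p (x : 'cV[R]_n) (y : 'cV[R]_p) c :
  0 <= c -> (enorm x <= c * enorm y) = (dot x x <= c ^+ 2 * dot y y).
Proof.
move=> c0; rewrite -!sqr_enorm -exprMn ler_pXn2r // ?nnegrE ?enorm_ge0 //.
by rewrite mulr_ge0 // enorm_ge0.
Qed.

Lemma enormZ n a (x : 'cV[R]_n) : enorm (a *: x) = `|a| * enorm x.
Proof.
by rewrite /enorm dotZl dotZr mulrA -expr2 sqrtrM ?sqr_ge0 // sqrtr_sqr.
Qed.

Lemma cauchy_schwarz n (x y : 'cV[R]_n) : dot x y <= enorm x * enorm y.
Proof.
have [->|y0] := eqVneq y 0.
  by rewrite /dot mulmx0 mxE mulr_ge0 ?enorm_ge0.
have yy : 0 < dot y y by rewrite lt_def dot_eq0 y0 dot_ge0.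
apply: (le_trans (ler_norm _)).
rewrite -(ler_pXn2r (ltn0Sn 1)) ?nnegrE ?normr_ge0 ?mulr_ge0 ?enorm_ge0 //.
rewrite exprMn !sqr_enorm -normrX ger0_norm ?sqr_ge0 //.
have := dot_ge0 (dot y y *: x + (- dot x y) *: y).
rewrite !(dotDl, dotDr, dotZl, dotZr) (dotC y x).
set a := dot x y; set b := dot y y; set c := dot x x => h.
have : 0 <= b * (c * b - a ^+ 2) by lra.
by rewrite pmulr_rge0 // subr_ge0.
Qed.

Lemma enorm_triangle n (x y : 'cV[R]_n) : enorm (x + y) <= enorm x + enorm y.
Proof.
rewrite -(ler_pXn2r (ltn0Sn 1)) ?nnegrE ?addr_ge0 ?enorm_ge0 //.
rewrite sqrrD !sqr_enorm dotDl !dotDr (dotC y x).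
have := cauchy_schwarz x y; lra.
Qed.

(** * Orthogonal matrices *)

Lemma dot_orthogonal_mx n (Q : 'M[R]_n) x y :
  orthogonal_mx Q -> dot (Q *m x) (Q *m y) = dot x y.
Proof. by rewrite dot_mulmx mulmxA => ->; rewrite mul1mx. Qed.

Lemma enorm_orthogonal_mx n (Q : 'M[R]_n) x :
  orthogonal_mx Q -> enorm (Q *m x) = enorm x.
Proof. by move=> oQ; rewrite /enorm dot_orthogonal_mx. Qed.

Lemma orthogonal_mxV n (Q : 'M[R]_n) : orthogonal_mx Q -> Q *m Q^T = 1%:M.
Proof. exact: mulmx1C. Qed.

Lemma orthogonal_trmx n (Q : 'M[R]_n) : orthogonal_mx Q -> orthogonal_mx Q^T.
Proof. by move=> oQ; rewrite /orthogonal_mx trmxK orthogonal_mxV. Qed.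

Lemma orthogonal_mulmx n (P Q : 'M[R]_n) :
  orthogonal_mx P -> orthogonal_mx Q -> orthogonal_mx (P *m Q).
Proof.
move=> oP oQ; rewrite /orthogonal_mx trmx_mul mulmxA -(mulmxA Q^T) oP mulmx1.
exact: oQ.
Qed.

Lemma orthogonal_mx1 n : orthogonal_mx (1%:M : 'M[R]_n).
Proof. by rewrite /orthogonal_mx trmx1 mulmx1. Qed.

(** * Vectors of maximal stretch *)

Definition norm_bound m n (M : 'M[R]_(m, n)) (c : R) :=
  forall x, enorm (M *m x) <= c * enorm x.

(** Expanding the square shows the map to be a polynomial in the coordinates. *)
Lemma dot_mulmx_continuous m n (M : 'M[R]_(m, n)) :
  continuous (fun v : 'rV[R]_n => dot (M *m v^T) (M *m v^T)).
Proof.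
have -> : (fun v : 'rV[R]_n => dot (M *m v^T) (M *m v^T)) =
  (fun v => \sum_i \sum_j \sum_k (M i j * M i k) * (v 0 j * v 0 k)).
  apply/funext => v; rewrite dotE; apply: eq_bigr => i _.
  rewrite !mxE big_distrl; apply: eq_bigr => j _.
  rewrite big_distrr; apply: eq_bigr => k _ /=.
  by rewrite !mxE; ring.
apply: continuous_big => [|i _]; first by move=> z; exact: add_continuous z.
apply: continuous_big => [|j _]; first by move=> z; exact: add_continuous z.
apply: continuous_big => [|k _ v]; first by move=> z; exact: add_continuous z.
have coordc l : {for v, continuous (fun x : 'rV[R]_n => x 0 l)}.
  exact: coord_continuous.
have cstc : {for v, continuous (fun=> M i j * M i k)} by exact: cst_continuous.
exact: continuousM cstc (continuousM (coordc j) (coordc k)).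
Qed.

Lemma compact_unit_sphere n :
  compact [set v : 'rV[R]_n | dot v^T v^T = 1]%classic.
Proof.
have dot1 (v : 'rV[R]_n) : dot v^T v^T = dot (1%:M *m v^T) (1%:M *m v^T).
  by rewrite mul1mx.
apply: bounded_closed_compact; last first.
  have -> : [set v : 'rV[R]_n | dot v^T v^T = 1]%classic =
      ((fun v => dot (1%:M *m v^T) (1%:M *m v^T)) @^-1`
        [set x : R | x = 1])%classic.
    by apply/funext => v /=; rewrite -dot1.
  apply: preimage_closed => [v _|]; last exact: closed_eq.
  exact: dot_mulmx_continuous.
exists 1; split=> // c c1 v /= v1.
apply: le_trans (ltW c1); rewrite [X in X <= _]mx_normrE.
apply/bigmax_leP; split=> // -[i j] _ /=.
rewrite ord1 -(ler_pXn2r (ltn0Sn 1)) ?nnegrE // expr1n -normrX.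
rewrite ger0_norm ?sqr_ge0 // -v1 dotE (bigD1 j) //= !mxE expr2 lerDl.
by rewrite sumr_ge0 // => l _; rewrite -expr2 sqr_ge0.
Qed.

(** The operator norm is attained, by continuity on the compact unit sphere. *)
Lemma norm_bound_max m n (M : 'M[R]_(m, n.+1)) :
  exists2 v, dot v v = 1 & norm_bound M (enorm (M *m v)).
Proof.
have S0 : ([set v : 'rV[R]_n.+1 | dot v^T v^T = 1] !=set0)%classic.
  exists (delta_mx 0 0) => /=.
  by rewrite /dot trmxK trmx_delta mul_delta_mx mxE !eqxx.
have [|v vS vmax] := compact_EVT_max S0 (@compact_unit_sphere n.+1)
  (f := fun v => dot (M *m v^T) (M *m v^T)).
  exact/continuous_subspaceT/dot_mulmx_continuous.
exists v^T; first by move: vS; rewrite inE.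
move=> x; have [->|x0] := eqVneq x 0.
  by rewrite mulmx0 /enorm /dot !mulmx0 !mxE sqrtr0 mulr0.
have nx : enorm x != 0 by rewrite enorm_eq0.
rewrite enorm_le ?enorm_ge0 // sqr_enorm.
have := vmax ((enorm x)^-1 *: x)^T; rewrite trmxK inE /= -scalemxAr.
rewrite !(dotZl, dotZr) -!sqr_enorm => vxmax.
have {vxmax} : (enorm x)^-1 * ((enorm x)^-1 * enorm (M *m x) ^+ 2) <=
    enorm (M *m v^T) ^+ 2.
  apply: vxmax; rewrite trmxK enormZ normfV ger0_norm ?enorm_ge0 //.
  by rewrite mulVf ?expr1n.
rewrite mulrA -expr2 exprVn ler_pdivrMl; first by rewrite mulrC.
by rewrite exprn_gt0 // lt_def nx enorm_ge0.
Qed.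

(** First-order condition at a maximiser v of |M x| / |x|, in algebraic form:
    the quadratic form s^2 |x|^2 - |M x|^2 is nonnegative and vanishes at v, so
    its gradient z at v, up to a factor 2, has to vanish too, since otherwise
    the form would be negative at a small step from v against z. *)
Lemma norm_bound_eigen m n (M : 'M[R]_(m, n)) v :
  norm_bound M (enorm (M *m v)) -> dot v v = 1 ->
  M^T *m (M *m v) = enorm (M *m v) ^+ 2 *: v.
Proof.
move=> Mb v1; set s := enorm (M *m v) in Mb *.
pose q x := s ^+ 2 * dot x x - dot (M *m x) (M *m x).
have q0 x : 0 <= q x by rewrite /q subr_ge0 -enorm_le ?enorm_ge0.
have [z zE] : exists z, z = s ^+ 2 *: v - M^T *m (M *m v) by eexists.
suff /eqP : dot z z = 0 by rewrite dot_eq0 zE subr_eq0 => /eqP.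
have qE t : q (v + t *: z) = 2 * t * dot z z + t ^+ 2 * q z.
  rewrite /q mulmxDr -scalemxAr !(dotDl, dotDr, dotZl, dotZr).
  have -> : dot z z = s ^+ 2 * dot v z - dot (M *m v) (M *m z).
    by rewrite dot_mulmx {1}zE -scaleN1r dotDl !dotZl mulN1r.
  rewrite (dotC z v) (dotC (M *m z)) v1 -[dot (M *m v) (M *m v)]sqr_enorm -/s.
  by ring.
set a := dot z z in qE *; set b := q z in qE *.
have b0 : 0 <= b by exact: q0.
(* b + 1 rather than b: the minimising step - a / b makes no sense if b = 0 *)
have : 0 <= q (v + (- a / (b + 1)) *: z) by exact: q0.
have b1 : b + 1 != 0 by lra.
have -> : q (v + (- a / (b + 1)) *: z) = - (a ^+ 2 * (b + 2) / (b + 1) ^+ 2).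
  by rewrite qE; field.
rewrite oppr_ge0 pmulr_lle0; last by rewrite invr_gt0 exprn_even_gt0.
rewrite pmulr_lle0; last by lra.
by move=> a0; apply/eqP; rewrite -sqrf_eq0 eq_le a0 sqr_ge0.
Qed.

(** * Householder reflections *)

Lemma dot_delta n (j : 'I_n) : dot (delta_mx j 0) (delta_mx j 0) = 1.
Proof. by rewrite /dot trmx_delta mul_delta_mx mxE !eqxx. Qed.

Lemma eq_mulmx_cV m n (M N : 'M[R]_(m, n)) :
  (forall x : 'cV_n, M *m x = N *m x) -> M = N.
Proof.
by move=> MN; apply/matrixP => i j; have /colP/(_ i) := MN (delta_mx j 0);
  rewrite -!colE !mxE.
Qed.

(** A unit vector other than the first coordinate vector e is exchanged with e
    by the reflection in the hyperplane orthogonal to their difference. *)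
Lemma householder n (u : 'cV[R]_n.+1) : dot u u = 1 ->
  exists2 Q : 'M[R]_n.+1, orthogonal_mx Q & Q *m delta_mx 0 0 = u.
Proof.
move=> u1; set e := delta_mx 0 0 : 'cV[R]_n.+1.
have [->|ue] := eqVneq u e.
  by exists 1%:M; [exact: orthogonal_mx1 | rewrite mul1mx].
have [w wE] : exists w, w = u - e by eexists.
have w0 : dot w w != 0 by rewrite dot_eq0 wE subr_eq0.
have ww : dot w w = - 2 * dot w e.
  rewrite wE -scaleN1r !(dotDl, dotDr, dotZl, dotZr) u1 dot_delta (dotC e u).
  by ring.
pose Q := 1%:M - (2 / dot w w) *: (w *m w^T).
have QE x : Q *m x = x - (2 / dot w w * dot w x) *: w.
  rewrite mulmxBl mul1mx -scalemxAl -mulmxA [w^T *m x]mx11_scalar.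
  by rewrite mul_mx_scalar scalerA.
have we0 : dot w e != 0 by apply: contraNneq w0 => we0; rewrite ww we0 mulr0.
exists Q; last first.
  have -> : u = e + w by rewrite wE addrC subrK.
  rewrite QE; have -> : 2 / dot w w * dot w e = -1 by rewrite ww; field.
  by rewrite scaleN1r opprK.
have QT : Q^T = Q by rewrite linearB /= linearZ /= trmx_mul trmxK trmx1.
rewrite /orthogonal_mx QT; apply: eq_mulmx_cV => x.
rewrite -mulmxA mul1mx QE.
have -> : dot w (Q *m x) = - dot w x.
  by rewrite QE -scaleN1r !(dotDr, dotZr); field.
by rewrite mulrN scaleNr opprK QE subrK.
Qed.

(** * Rectangular diagonal matrices *)

(** The column sums stand for the squared diagonal entries: a column of index
    at least m has no diagonal entry, and its sum is then zero. *)
Lemma dot_diag_mx m n (S : 'M[R]_(m, n)) y : is_diag_mx S ->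
  dot (S *m y) (S *m y) = \sum_j (\sum_i S i j ^+ 2) * y j 0 ^+ 2.
Proof.
move=> /is_diag_mxP S0; rewrite dotE.
under [RHS]eq_bigr do rewrite big_distrl /=.
rewrite [RHS]exchange_big /=; apply: eq_bigr => i _; rewrite mxE big_distrl /=.
apply: eq_bigr => j _; have [->|Sij] := eqVneq (S i j) 0.
  by rewrite expr0n !mul0r.
rewrite (bigD1 j) //= big1 => [|k kj]; first by rewrite addr0; ring.
rewrite (S0 i k) ?mul0r //; apply: contra_neqN kj => /eqP ik.
apply/ord_inj; rewrite -ik; apply/eqP; apply: contraNT Sij => /S0 ->.
by rewrite eqxx.
Qed.

Lemma diag_col_sqr m n (S : 'M[R]_(m, n)) (i : 'I_m) (j : 'I_n) :
  is_diag_mx S -> i = j :> nat -> \sum_i S i j ^+ 2 = S i j ^+ 2.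
Proof.
move=> /is_diag_mxP S0 ij; rewrite (bigD1 i) //= big1 ?addr0 // => k ki.
by rewrite S0 ?expr0n // -ij.
Qed.

Lemma diag_norm_bound m n (S : 'M[R]_(m, n)) (c : R) : is_diag_mx S -> 0 <= c ->
  (forall (i : 'I_m) (j : 'I_n), i = j :> nat -> `|S i j| <= c) ->
  norm_bound S c.
Proof.
move=> dS c0 Sc x; rewrite enorm_le // dot_diag_mx // dotE big_distrr /=.
apply: ler_sum => j _; rewrite -expr2 ler_wpM2r ?sqr_ge0 //.
have [jm|mj] := ltnP j m.
  rewrite (diag_col_sqr (i := Ordinal jm)) //.
  rewrite -[S _ _ ^+ 2]ger0_norm ?sqr_ge0 //.
  by rewrite normrX ler_pXn2r ?nnegrE // Sc.
rewrite big1 ?sqr_ge0 // => i _.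
by rewrite (is_diag_mxP dS) ?expr0n // ltn_eqF // (leq_trans (ltn_ord i)).
Qed.

(** * Consequences of a singular value decomposition *)

Lemma svd_norm m n (A : 'M[R]_(m, n)) U S V x : is_svd A U S V ->
  enorm (A *m x) = enorm (S *m (V^T *m x)).
Proof. by case=> -[oU oV] _ _ _ ->; rewrite -!mulmxA enorm_orthogonal_mx. Qed.

(** The j-th column of V is stretched by exactly the j-th singular value. *)
Lemma svd_entry_le m n (A : 'M[R]_(m, n)) U S V c (i : 'I_m) (j : 'I_n) :
  is_svd A U S V -> norm_bound A c -> i = j :> nat -> S i j <= c.
Proof.
move=> svdA Ac ij; have [[oU oV] dS S0 _ _] := svdA.
have := Ac (V *m delta_mx j 0).
rewrite (svd_norm _ svdA) enorm_orthogonal_mx // (mulmxA V^T) oV mul1mx.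
have -> : enorm (delta_mx j 0 : 'cV[R]_n) = 1.
  by rewrite /enorm dot_delta sqrtr1.
suff -> : enorm (S *m delta_mx j 0) = S i j by rewrite mulr1.
rewrite /enorm dot_diag_mx // (bigD1 j) //= (diag_col_sqr (i := i)) // mxE.
rewrite !eqxx big1 ?addr0 => [|k kj].
  by rewrite expr1n mulr1 sqrtr_sqr ger0_norm ?S0.
by rewrite mxE (negPf kj) expr0n mulr0.
Qed.

Lemma svd_norm_bound m n (A : 'M[R]_(m, n)) U S V c : is_svd A U S V ->
  0 <= c -> (forall (i : 'I_m) (j : 'I_n), i = j :> nat -> S i j <= c) ->
  norm_bound A c.
Proof.
move=> svdA c0 Sc x; have [[oU oV] dS S0 _ _] := svdA.
rewrite (svd_norm _ svdA).
rewrite -[enorm x](enorm_orthogonal_mx _ (orthogonal_trmx oV)).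
by apply: diag_norm_bound => // i j ij; rewrite ger0_norm ?S0 ?Sc.
Qed.

(** * Existence of singular value decompositions *)

Lemma is_svd0 m n : is_svd (0 : 'M[R]_(m, n)) 1%:M 0 1%:M.
Proof.
split; first by split; exact: orthogonal_mx1.
- by apply/is_diag_mxP => i j _; rewrite mxE.
- by move=> i j _; rewrite mxE.
- by move=> i i' j j' _ _ _; rewrite !mxE.
- by rewrite mulmx0 mul0mx.
Qed.

Lemma norm_bound_orthogonal_mx m n (A : 'M[R]_(m, n)) P Q c :
  orthogonal_mx P -> orthogonal_mx Q -> norm_bound A c ->
  norm_bound (P *m A *m Q) c.
Proof.
move=> oP oQ Ac x; rewrite -!mulmxA enorm_orthogonal_mx //.
by rewrite -(enorm_orthogonal_mx x oQ).
Qed.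

Lemma is_svd_orthogonal_mx m n (A : 'M[R]_(m, n)) P Q U S V :
  orthogonal_mx P -> orthogonal_mx Q -> is_svd (P^T *m A *m Q) U S V ->
  is_svd A (P *m U) S (Q *m V).
Proof.
move=> oP oQ [[oU oV] dS S0 Sd AE]; split=> //.
  by split; apply: orthogonal_mulmx.
rewrite trmx_mul -!mulmxA (mulmxA S) (mulmxA U) (mulmxA U) -AE.
by rewrite -!mulmxA orthogonal_mxV // mulmx1 mulmxA orthogonal_mxV // mul1mx.
Qed.

Lemma orthogonal_block_mx1 n (Q : 'M[R]_n) : orthogonal_mx Q ->
  orthogonal_mx (block_mx (1%:M : 'M_1) 0 0 Q : 'M_(1 + n)).
Proof.
move=> oQ; rewrite /orthogonal_mx tr_block_mx mulmx_block oQ.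
rewrite !trmx0 trmx1 !(mulmx0, mul0mx) !mulmx1 ?addr0 ?add0r.
exact: esym (scalar_mx_block _ _ _).
Qed.

(** The hypothesis that s bounds the norm of A keeps the diagonal entries in
    non-increasing order when s is placed in front of them. *)
Lemma is_svd_block_mx m n (A : 'M[R]_(m, n)) U S V s :
  0 <= s -> norm_bound A s -> is_svd A U S V ->
  is_svd (block_mx (s%:M : 'M_1) 0 0 A : 'M_(1 + m, 1 + n))
    (block_mx 1%:M 0 0 U) (block_mx s%:M 0 0 S) (block_mx 1%:M 0 0 V).
Proof.
move=> s0 As svdA; have [[oU oV] dS S0 Sd AE] := svdA.
have Ss := svd_entry_le svdA As.
split.
- by split; apply: orthogonal_block_mx1.
- apply/is_diag_mxP => i j.
  case: (split_ordP i) => i' ->; case: (split_ordP j) => j' ->;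
    rewrite ?(block_mxEul, block_mxEur, block_mxEdl, block_mxEdr) ?mxE //=.
    by rewrite !ord1 eqxx.
  by rewrite eqn_add2l => /(is_diag_mxP dS).
- move=> i j.
  case: (split_ordP i) => i' ->; case: (split_ordP j) => j' ->;
    rewrite ?(block_mxEul, block_mxEur, block_mxEdl, block_mxEdr) ?mxE //=.
    by rewrite !ord1 eqxx.
  by move=> [/S0].
- move=> i i' j j'.
  case: (split_ordP i) => {}i ->; case: (split_ordP j) => {}j ->;
  case: (split_ordP i') => {}i' ->; case: (split_ordP j') => {}j' ->;
    rewrite ?(block_mxEul, block_mxEur, block_mxEdl, block_mxEdr) ?mxE //=;
    rewrite ?ord1 ?eqxx //=.
    by move=> _ [/Ss].
  by move=> [ij] [ij'] /(Sd _ _ _ _ ij ij').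
rewrite tr_block_mx !trmx0 trmx1 !mulmx_block AE.
by rewrite !(mulmx0, mul0mx, mulmx1, mul1mx, addr0, add0r).
Qed.

Lemma enorm_col_mx0 m n (x : 'cV[R]_n) : enorm (col_mx (0 : 'cV_m) x) = enorm x.
Proof. by rewrite /enorm /dot tr_col_mx mul_row_col mulmx0 add0r. Qed.

Lemma norm_bound_block_mx m1 m n1 n (A0 : 'M[R]_(m1, n1)) (A : 'M[R]_(m, n)) c :
  norm_bound (block_mx A0 0 0 A) c -> norm_bound A c.
Proof.
move=> Bc x; have := Bc (col_mx 0 x).
by rewrite mul_block_col !(mulmx0, mul0mx, add0r) !enorm_col_mx0.
Qed.

(** Deflation: the top singular vectors split off as a 1 x 1 block.  Choosing s
    maximal is what makes the remaining singular values at most s. *)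
Theorem svd_exists m n (A : 'M[R]_(m, n)) : exists U S V, is_svd A U S V.
Proof.
elim: m n A => [|m IHm] n A.
  by rewrite (flatmx0 A); do 3 eexists; exact: is_svd0.
case: n A => [|n] A; first by rewrite (thinmx0 A); do 3 eexists; exact: is_svd0.
have [v v1 Av] := norm_bound_max A.
have Hv := norm_bound_eigen Av v1.
have s_ge0 := enorm_ge0 (A *m v).
have sE := sqr_enorm (A *m v).
move: (enorm (A *m v)) => s in Av Hv s_ge0 sE.
have [s0|s0] := eqVneq s 0.
  suff -> : A = 0 by do 3 eexists; exact: is_svd0.
  apply: eq_mulmx_cV => x; apply/eqP; rewrite mul0mx -enorm_eq0.
  by rewrite eq_le enorm_ge0 andbT (le_trans (Av x)) // s0 mul0r.
pose u := s^-1 *: (A *m v).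
have u1 : dot u u = 1 by rewrite dotZl dotZr -sE; field.
have [P oP Pu] := householder u1; have [Q oQ Qv] := householder v1.
(* B is abstracted, so that its entries do not unfold under mxE *)
have [B BPQ] : exists B, B = P^T *m A *m Q by eexists.
have Be : B *m delta_mx 0 0 = s *: delta_mx 0 0 :> 'cV_m.+1.
  rewrite BPQ -!mulmxA Qv.
  have -> : A *m v = s *: u by rewrite scalerA mulfV ?scale1r.
  by rewrite -Pu -scalemxAr mulmxA oP mul1mx.
have BTe : B^T *m delta_mx 0 0 = s *: delta_mx 0 0 :> 'cV_n.+1.
  rewrite BPQ !trmx_mul trmxK -!mulmxA Pu -scalemxAr Hv scalerA.
  by rewrite -Qv -scalemxAr mulmxA oQ mul1mx expr2 mulKf.
pose A' : 'M_(m, n) := @drsubmx R 1 m 1 n B.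
have BE : B = block_mx (s%:M : 'M_1) 0 0 A' :> 'M_(1 + m, 1 + n).
  rewrite -[LHS](@submxK R 1 m 1 n); congr block_mx => //;
    apply/matrixP => i j; rewrite !mxE.
  - have /colP/(_ 0) := Be; rewrite -colE !mxE !eqxx mulr1 !ord1.
    rewrite eqxx mulr1n => <-.
    by congr (B _ _); apply/ord_inj.
  - have /colP/(_ (rshift 1 j)) := BTe; rewrite -colE !mxE mulr0 !ord1 => <-.
    by congr (B _ _); apply/ord_inj.
  - have /colP/(_ (rshift 1 i)) := Be; rewrite -colE !mxE mulr0 !ord1 => <-.
    by congr (B _ _); apply/ord_inj.
have A's : norm_bound A' s.
  apply: (@norm_bound_block_mx 1 m 1 n s%:M); rewrite -BE BPQ.
  exact: norm_bound_orthogonal_mx (orthogonal_trmx oP) oQ Av.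
have [U [S [V svdA']]] := IHm _ A'.
have := is_svd_block_mx s_ge0 A's svdA'; rewrite -BE BPQ => svdB.
by do 3 eexists; exact: is_svd_orthogonal_mx oP oQ svdB.
Qed.

(** * The two-norm as the operator norm *)

Lemma two_norm_le m n (A : 'M[R]_(m, n)) c :
  0 <= c -> norm_bound A c -> two_norm A <= c.
Proof.
move=> c0 Ac; rewrite /two_norm.
have [->|/set0P sv0] := eqVneq (singular_values A) set0; first by rewrite sup0.
apply: ge_sup => // _ [U [S [V [i [j [svdA ij ->]]]]]].
exact: svd_entry_le svdA Ac ij.
Qed.

(** Makes the set of singular values bounded above, so that its supremum is
    meaningful. *)
Lemma norm_bound_exists m n (A : 'M[R]_(m, n)) : exists c, norm_bound A c.
Proof.
case: n A => [|n] A; last first.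
  by have [v _ Av] := norm_bound_max A; exists (enorm (A *m v)).
exists 0 => x.
by rewrite (flatmx0 x) mulmx0 /enorm /dot !mulmx0 !mxE sqrtr0 mulr0.
Qed.

Lemma singular_values_le_two_norm m n (A : 'M[R]_(m, n)) s :
  singular_values A s -> s <= two_norm A.
Proof.
apply: ub_le_sup; have [c Ac] := norm_bound_exists A.
exists c => _ [U [S [V [i [j [svdA ij ->]]]]]].
exact: svd_entry_le svdA Ac ij.
Qed.

Lemma two_norm_ge0 m n (A : 'M[R]_(m, n)) : 0 <= two_norm A.
Proof.
have [sv0|/set0P[s As]] := eqVneq (singular_values A) set0.
  by rewrite /two_norm sv0 sup0.
apply: le_trans (singular_values_le_two_norm As).
by case: As => [U [S [V [i [j [[_ _ S0 _ _] ij ->]]]]]]; exact: S0.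
Qed.

Lemma two_norm_bound m n (A : 'M[R]_(m, n)) : norm_bound A (two_norm A).
Proof.
have [U [S [V svdA]]] := svd_exists A.
apply: (svd_norm_bound svdA (two_norm_ge0 A)) => i j ij.
by apply: singular_values_le_two_norm; exists U, S, V, i, j.
Qed.

Lemma two_normD m n (A B : 'M[R]_(m, n)) :
  two_norm (A + B) <= two_norm A + two_norm B.
Proof.
apply: two_norm_le => [|x]; first by rewrite addr_ge0 ?two_norm_ge0.
rewrite mulmxDl mulrDl (le_trans (enorm_triangle _ _)) //.
by apply: lerD; exact: two_norm_bound.
Qed.

Lemma two_normN m n (A : 'M[R]_(m, n)) : two_norm (- A) = two_norm A.
Proof.
have le B : two_norm (- B) <= two_norm (B : 'M[R]_(m, n)).
  apply: two_norm_le => [|x]; first exact: two_norm_ge0.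
  by rewrite mulNmx -scaleN1r enormZ normrN1 mul1r; exact: two_norm_bound.
by apply/eqP; rewrite eq_le le /= -{1}[A]opprK le.
Qed.

(** Pythagoras: removing the component of a vector along the orthonormal
    columns of Q shortens it. *)
Lemma two_norm_mulmx_proj m n k (Q : 'M[R]_(m, k)) (A : 'M[R]_(m, n)) :
  Q^T *m Q = 1%:M -> two_norm ((1%:M - Q *m Q^T) *m A) <= two_norm A.
Proof.
move=> oQ; apply: two_norm_le => [|x]; first exact: two_norm_ge0.
apply: le_trans (two_norm_bound A x).
rewrite -mulmxA -[leRHS]mul1r enorm_le // expr1n mul1r.
move: (A *m x) => {}y; rewrite mulmxBl mul1mx -mulmxA -scaleN1r.
rewrite !(dotDl, dotDr, dotZl, dotZr) (dotC _ y).
have -> : dot (Q *m (Q^T *m y)) (Q *m (Q^T *m y)) = dot (Q^T *m y) (Q^T *m y).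
  by rewrite dot_mulmx mulmxA oQ mul1mx.
have -> : dot y (Q *m (Q^T *m y)) = dot (Q^T *m y) (Q^T *m y).
  by rewrite dot_mulmx.
by have := dot_ge0 (Q^T *m y); lra.
Qed.

(** * Optimality of dominant singular subspaces *)

Section LeadingCoordinates.
Variables (k m : nat) (le_km : (k <= m)%N).

(** The inclusion of R^k into R^m as the span of the first k coordinates.  It
    turns the selection of leading columns into a matrix product. *)
Definition incl_mx : 'M[R]_(m, k) := colsub (widen_ord le_km) 1%:M.

Lemma mulmx_incl_mx n (A : 'M[R]_(n, m)) :
  A *m incl_mx = colsub (widen_ord le_km) A.
Proof. by rewrite mulmx_colsub mulmx1. Qed.

Lemma incl_mx_lead n (N : 'M[R]_(k, n)) (p : 'I_k) (j : 'I_n) :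
  (incl_mx *m N) (widen_ord le_km p) j = N p j.
Proof.
rewrite mxE (bigD1 p) //= !mxE eqxx mul1r big1 ?addr0 // => q qp.
by rewrite !mxE -val_eqE /= eq_sym (negPf qp : val q == val p = false) mul0r.
Qed.

Lemma incl_mx_tail n (N : 'M[R]_(k, n)) (i : 'I_m) (j : 'I_n) :
  (k <= i)%N -> (incl_mx *m N) i j = 0.
Proof.
move=> ki; rewrite mxE big1 // => p _.
rewrite !mxE -val_eqE /= gtn_eqF ?mul0r //.
exact: leq_trans ki.
Qed.

Lemma tr_incl_mulmx n (N : 'M[R]_(m, n)) (p : 'I_k) (j : 'I_n) :
  (incl_mx^T *m N) p j = N (widen_ord le_km p) j.
Proof. by rewrite trmx_mxsub trmx1 mul_rowsub_mx mul1mx mxE. Qed.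

Lemma incl_mxK n (N : 'M[R]_(k, n)) : incl_mx^T *m (incl_mx *m N) = N.
Proof. by apply/matrixP => p j; rewrite tr_incl_mulmx incl_mx_lead. Qed.
End LeadingCoordinates.

Lemma kernel_exists m n (B : 'M[R]_(m, n)) : (\rank B < n)%N ->
  exists2 y : 'cV_n, y != 0 & B *m y = 0.
Proof.
move=> rB; have : kermx B^T != 0.
  by rewrite -mxrank_eq0 mxrank_ker mxrank_tr -lt0n subn_gt0.
case/rowV0Pn => y /sub_kermxP yB y0; exists y^T; first by rewrite trmx_eq0.
by apply: trmx_inj; rewrite trmx_mul trmxK yB trmx0.
Qed.

(** The lower bound of Eckart and Young: the span of the first i + 1 right
    singular vectors has too large a dimension for B to be injective on it. *)
Lemma svd_entry_le_dist m n (M B : 'M[R]_(m, n)) U S V (i : 'I_m) (j : 'I_n) :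
  is_svd M U S V -> i = j :> nat -> (\rank B <= i)%N ->
  S i j <= two_norm (M - B).
Proof.
move=> svdM ij rB; have [[oU oV] dS S0 Sd _] := svdM.
have [|y y0 By] := @kernel_exists _ j.+1 (B *m V *m incl_mx (ltn_ord j)).
  rewrite ltnS (leq_trans _ (_ : \rank B <= j)%N) -?ij //.
  by rewrite -mulmxA mxrankM_maxl.
(* V z lies in the kernel of B and in the span of the leading columns of V *)
set z := incl_mx (ltn_ord j) *m y.
have z0 : z != 0.
  apply: contraNneq y0 => z0; apply/eqP/colP => p.
  by rewrite -(incl_mx_lead (ltn_ord j)) -/z z0 !mxE.
have nz : 0 < enorm z by rewrite lt_def enorm_eq0 z0 enorm_ge0.
rewrite -(ler_pM2r nz).
apply: (@le_trans _ _ (enorm ((M - B) *m (V *m z)))); last first.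
  by rewrite -(enorm_orthogonal_mx z oV); exact: two_norm_bound.
have -> : (M - B) *m (V *m z) = M *m (V *m z).
  by rewrite mulmxBl /z !mulmxA By subr0.
rewrite (svd_norm _ svdM) (mulmxA V^T) oV mul1mx.
rewrite -(ler_pXn2r (ltn0Sn 1)) ?nnegrE ?mulr_ge0 ?enorm_ge0 ?S0 //.
rewrite exprMn !sqr_enorm dot_diag_mx // dotE big_distrr /=.
apply: ler_sum => l _; rewrite -expr2.
have [lj|jl] := leqP l j; last by rewrite /z incl_mx_tail // expr0n !mulr0.
have lm : (l < m)%N by apply: leq_ltn_trans lj _; rewrite -ij.
rewrite ler_wpM2r ?sqr_ge0 // (diag_col_sqr (i := Ordinal lm)) //.
by rewrite ler_pXn2r ?nnegrE ?S0 // Sd //= ij.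
Qed.

(** With J the inclusion of the first k coordinates, the residual of M is
    U (S - J J^T S) V^T: the projection erases the first k rows of S, and
    [svd_entry_le_dist] bounds each entry that is left. *)
Theorem dominant_projection_optimal m n k (M B : 'M[R]_(m, n))
    (Uk : 'M_(m, k)) :
  dominant_left_singular_vectors M Uk -> (\rank B <= k)%N ->
  two_norm ((1%:M - Uk *m Uk^T) *m M) <= two_norm (M - B).
Proof.
move=> [U [S [V [le_km [svdM ->]]]]] rB; have [[oU oV] dS S0 Sd ME] := svdM.
apply: two_norm_le => [|x]; first exact: two_norm_ge0.
rewrite -mulmx_incl_mx; set J := incl_mx le_km.
have -> : (1%:M - U *m J *m (U *m J)^T) *m M =
    U *m (S - J *m (J^T *m S)) *m V^T.
  rewrite ME mulmxBl mul1mx mulmxBr mulmxBl trmx_mul -!mulmxA (mulmxA U^T) oU.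
  by rewrite mul1mx.
have TSE (i : 'I_m) (j : 'I_n) :
    (S - J *m (J^T *m S)) i j = if (i < k)%N then 0 else S i j.
  rewrite mxE [X in _ + X]mxE; have [ik|ki] := ltnP i k; last first.
    by rewrite incl_mx_tail // subr0.
  have -> : i = widen_ord le_km (Ordinal ik) by apply: ord_inj.
  by rewrite incl_mx_lead tr_incl_mulmx subrr.
rewrite -!mulmxA enorm_orthogonal_mx //.
rewrite -(enorm_orthogonal_mx x (orthogonal_trmx oV)).
apply: diag_norm_bound; first 1 last.
- exact: two_norm_ge0.
- move=> i j ij; rewrite TSE; case: ltnP => [_|ki].
    by rewrite normr0 two_norm_ge0.
  by rewrite ger0_norm ?S0 // (svd_entry_le_dist svdM) // (leq_trans rB).
- apply/is_diag_mxP => i j ij; rewrite TSE (is_diag_mxP dS) //; exact: if_same.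
Qed.

Lemma dominant_orthonormal m n k (M : 'M[R]_(m, n)) (Uk : 'M_(m, k)) :
  dominant_left_singular_vectors M Uk -> Uk^T *m Uk = 1%:M.
Proof.
move=> [U [S [V [le_km [[[oU _] _ _ _ _] ->]]]]].
rewrite -mulmx_incl_mx trmx_mul mulmxA -(mulmxA _ U^T) oU mulmx1.
by rewrite -[RHS](incl_mxK le_km) mulmx1.
Qed.
End Euclidean.

(** * Residuals of exact and perturbed dominant projections *)

Theorem corollary2 (R : realType) (m n k : nat) (A E : 'M[R]_(m, n))
    (Uk Uhk : 'M[R]_(m, k))
    (hk : (1 <= k <= \rank A)%N)
    (hU : dominant_left_singular_vectors A Uk)
    (hUh : dominant_left_singular_vectors (A + E) Uhk) :
  two_norm ((1%:M - Uk *m Uk^T) *m A)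
    <= two_norm ((1%:M - Uhk *m Uhk^T) *m A)
    <= two_norm ((1%:M - Uk *m Uk^T) *m A) + 2 * two_norm E.
Proof.
have rank_proj (Q : 'M[R]_(m, k)) : (\rank (Q *m Q^T *m A) <= k)%N.
  by rewrite -mulmxA (leq_trans (mxrankM_maxl _ _)) // rank_leq_col.
have residualE (Q : 'M[R]_(m, k)) : (1%:M - Q *m Q^T) *m A = A - Q *m Q^T *m A.
  by rewrite mulmxBl mul1mx.
apply/andP; split.
  (* the competitor is the projection of A onto the other subspace *)
  by rewrite [in leRHS]residualE; exact: dominant_projection_optimal.
have oUh := dominant_orthonormal hUh.
have -> : (1%:M - Uhk *m Uhk^T) *m A =
    (1%:M - Uhk *m Uhk^T) *m (A + E) - (1%:M - Uhk *m Uhk^T) *m E.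
  by rewrite mulmxDr addrK.
(* the competitor is the projection of A, not of A + E *)
have opt := dominant_projection_optimal hUh (rank_proj Uk).
have split1 := two_normD ((1%:M - Uhk *m Uhk^T) *m (A + E))
  (- ((1%:M - Uhk *m Uhk^T) *m E)).
have projE := two_norm_mulmx_proj E oUh.
have split2 := two_normD ((1%:M - Uk *m Uk^T) *m A) E.
rewrite two_normN in split1; rewrite residualE addrAC in split2.
rewrite (residualE Uk); lra.
Qed.
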